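(* Let $G=C_n$ be the cycle on $n\ge3$ vertices and let $\mathbb{K}$ be a field. Then the ideal $I(\overline{\mathcal{C}_r(G)})$ has a linear resolution for all integers $r\ge2$.
   Context: For a finite simple graph $G$ and $r\ge1$, $\mathcal{C}_r(G)$ is the $(r+1)$-uniform clutter on $V(G)$ whose edges are the sets $S\subseteq V(G)$ with $|S|=r+1$ and induced subgraph $G[S]$ connected; $\overline{\mathcal{C}_r(G)}$ is the clutter on $V(G)$ whose edges are the $(r+1)$-subsets of $V(G)$ that are not edges of $\mathcal{C}_r(G)$. For a clutter $\mathcal{C}$, $I(\mathcal{C})$ is the ideal generated by the monomials $\prod_{x\in e}x$, $e\in E(\mathcal{C})$, in the polynomial ring over $\mathbb{K}$ with variables the vertices of $\mathcal{C}$. A homogeneous ideal $I$ generated in a single degree $d$ has a linear resolution if its graded Betti numbers satisfy $\beta_{i,j}(I)=0$ whenever $j\neq i+d$; the zero ideal is regarded as having a linear resolution. *)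

(* Defs.v *)
From HB Require Import structures.
From mathcomp Require Import all_boot all_order all_algebra.
From mathcomp Require Import mpoly.
Set Implicit Arguments.
Unset Strict Implicit.
Unset Printing Implicit Defensive.
Import GRing.Theory.
Local Open Scope ring_scope.

(* A simple graph is given by its (symmetric, irreflexive) adjacency relation;
   a d-uniform clutter by its set of edges, all of cardinality d. *)

Definition cycle_graph (n : nat) : rel 'I_n :=
  fun i j => (j == i.+1 %[mod n])%N || (i == j.+1 %[mod n])%N.
Arguments cycle_graph n _ _ : clear implicits.

Lemma cycle_graph_sym n : ssrbool.symmetric (cycle_graph n).
Proof. by move=> i j; rewrite /cycle_graph orbC. Qed.

Lemma cycle_graph_irr n : (1 < n)%N -> irreflexive (cycle_graph n).
Proof.
move=> n_gt1 i; rewrite /cycle_graph orbb -addn1 -[X in X == _ %[mod n]]addn0.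
by rewrite eqn_modDl mod0n modn_small.
Qed.

Section Clutters.
Variable V : finType.

Definition induced (G : rel V) (S : {set V}) : rel V :=
  [rel x y | [&& x \in S, y \in S & G x y]].

Definition induced_connected (G : rel V) (S : {set V}) : bool :=
  (S != set0) && [forall x in S, forall y in S, connect (induced G S) x y].

Definition connected_clutter (r : nat) (G : rel V) : {set {set V}} :=
  [set S : {set V} | (#|S| == r.+1) && induced_connected G S].

Definition clutter_compl (d : nat) (C : {set {set V}}) : {set {set V}} :=
  [set S : {set V} | (#|S| == d) && (S \notin C)].

End Clutters.

Section Ideals.
Variables (K : fieldType) (n : nat).
Local Notation S := {mpoly K[n]}.

Definition ideal_gen (s : seq S) (p : S) : Prop :=
  exists c : 'I_(size s) -> S, p = \sum_(i < size s) c i * s`_i.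

Definition edge_monomial (e : {set 'I_n}) : S := \prod_(x in e) 'X_x.

Definition edge_ideal (C : {set {set 'I_n}}) : S -> Prop :=
  ideal_gen [seq edge_monomial e | e <- enum C].

(* The matrix A, acting on row vectors on the right, is a degree-preserving
   map from (+)_k S(- a k) to (+)_l S(- b l): the entry A k l is zero or
   homogeneous of degree a k - b l. *)
Definition graded_map p q (a : 'I_p -> nat) (b : 'I_q -> nat)
    (A : 'M[S]_(p, q)) : Prop :=
  forall k l m, m \in msupp (A k l) -> (mdeg m + b l)%N = a k.

(* F_i = (+)_(k < rank i) S(- shift i k), with maps F_(i+1) -> F_i and an
   augmentation F_0 -> S.  Natural shifts suffice: an ideal of S has no
   nonzero element of negative degree. *)
Record free_complex := FreeComplex {
  rank : nat -> nat;
  shift : forall i, 'I_(rank i) -> nat;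
  diff : forall i, 'M[S]_(rank i.+1, rank i);
  aug : 'cV[S]_(rank 0) }.

Definition graded_complex (F : free_complex) : Prop :=
  (forall i, graded_map (@shift F i.+1) (@shift F i) (diff F i)) /\
  graded_map (@shift F 0) (fun _ : 'I_1 => 0%N) (aug F).

Definition resolution_of (I : S -> Prop) (F : free_complex) : Prop :=
  [/\ forall p : S, I p <-> exists v : 'rV_(rank F 0), v *m aug F = p%:M,
      forall v : 'rV_(rank F 0),
        v *m aug F = 0 <-> exists w, v = w *m diff F 0
    & forall i (v : 'rV_(rank F i.+1)),
        v *m diff F i = 0 <-> exists w, v = w *m diff F i.+1].

(* Every differential maps F_(i+1) into (x_1, ..., x_n) F_i. *)
Definition minimal_complex (F : free_complex) : Prop :=
  forall i k l, (diff F i k l)@_0%MM = 0.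

Definition minimal_graded_resolution (I : S -> Prop) (F : free_complex) :=
  [/\ graded_complex F, resolution_of I F & minimal_complex F].

(* beta i j is the graded Betti number beta_(i,j)(I): the number of summands
   S(-j) in step i of a minimal graded free resolution of I.  Such a
   resolution is unique up to isomorphism, hence so is beta. *)
Definition graded_betti (I : S -> Prop) (beta : nat -> nat -> nat) : Prop :=
  exists2 F : free_complex, minimal_graded_resolution I F &
    forall i j, beta i j = #|[set k : 'I_(rank F i) | shift k == j]|.

Definition generated_in_degree (d : nat) (I : S -> Prop) : Prop :=
  exists2 s : seq S, all (fun f => f \is d.-homog) s &
    forall p, I p <-> ideal_gen s p.

Definition has_linear_resolution (I : S -> Prop) : Prop :=
  (forall p, I p <-> p = 0) \/
  exists2 d, generated_in_degree d I &
    exists2 beta, graded_betti I beta &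
      forall i j, j != (i + d)%N -> beta i j = 0%N.

End Ideals.

Arguments edge_ideal K {n} C _.

(* Main.v *)
Require Import Defs.
From mathcomp Require Import all_boot all_order all_algebra.
From mathcomp Require Import mpoly zify.

(** Let d = r + 1 >= 3.  A nonempty vertex set of the cycle is disconnected
    exactly when it has at least two ends, an end being a vertex of the set
    whose successor lies outside.  The ideal is therefore generated by the
    squarefree monomials x_A, where A runs over the d-subsets that are not arcs.

    Taken in lexicographic order, these monomials have linear quotients: each
    colon ideal (x_B : B before A) : x_A is generated by variables.  On sets
    this is an exchange property (lex_exchange): if the non-arc B comes before
    A, then some x in B \ A has the property that trading an element of A for x
    gives an earlier non-arc.  The natural choice is x = w, the first place
    where A and B differ, traded for some y > w.  Among all d-subsets any such y
    would do; here the traded set might be an arc.  If it is an arc both for the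
    least y and for the last vertex, then A must be {0, ..., d-3, d-1, last} and
    B must be {0, ..., d-2, t}, and trading the last vertex for t works instead.
    This is where d >= 3 enters: the vertex d-3 is then an end of the new set,
    besides t.

    Linear quotients give a linear resolution by iterated mapping cones
    (has_linres_add).  If F resolves I linearly, m is homogeneous of degree d
    and G resolves the ideal I : m linearly in degree 1, then the cone of a
    comparison map lifting multiplication by m, from the resolution of
    S / (I : m) to that of S / I, resolves I + (m).  All the blocks of the cone
    are homogeneous with the right degrees, because a lift of a homogeneous
    cycle can be replaced by its homogeneous part; a complex whose
    differentials consist of linear forms is automatically minimal.  The same
    step resolves the ideals generated by variables, since
    (x_1, ..., x_k) : x_(k+1) = (x_1, ..., x_k), so that the Koszul complexes
    needed as G are themselves iterated cones. *)

Set Implicit Arguments.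
Unset Strict Implicit.
Unset Printing Implicit Defensive.

(** * Linear resolutions and mapping cones *)

(** The comparison map between two resolutions is built this way, one degree at
    a time.  Since P and R are boolean predicates on types with a choice
    operator, the choices need no axiom. *)
Lemma dependent_chain (T : nat -> choiceType) (P : forall i, pred (T i))
    (R : forall i, T i -> pred (T i.+1)) (x0 : T 0%N) :
  P 0%N x0 -> (forall i x, P i x -> exists y, P i.+1 y && R i x y) ->
  exists2 f : forall i, T i, f 0%N = x0 &
    forall i, P i (f i) /\ R i (f i) (f i.+1).
Proof.
move=> P0 step.
have next i (u : {x : T i | P i x}) :
    {v : {y : T i.+1 | P i.+1 y} | R i (val u) (val v)}.
  by have [y /andP[Py Ry]] := sigW (step i _ (valP u)); exists (exist _ y Py).
pose g := nat_rect (fun i => {x : T i | P i x}) (exist _ x0 P0)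
            (fun i u => val (next i u)).
exists (fun i => val (g i)) => // i; split; first exact: (valP (g i)).
exact: (valP (next i (g i))).
Qed.

Section Resolutions.
Import GRing.Theory.
Local Open Scope ring_scope.
Variables (K : fieldType) (n : nat).
Local Notation S := {mpoly K[n]}.
Local Notation homog_part := (pihomog (Measure.clone _ mdeg _)).
Implicit Types (p q : S) (F : free_complex K n) (I J : S -> Prop).

Lemma pihomogM_homog d e p q : q \is e.-homog ->
  homog_part (d + e) (p * q) = homog_part d p * q.
Proof.
move=> hq; pose N := maxn (mmeasure (Measure.clone _ mdeg _) p) d.+1.
have dN : (d < N)%N by rewrite leq_max leqnn orbT.
rewrite {1}(@pihomog_partitionE _ _ (Measure.clone _ mdeg _) N p) ?leq_maxl //.
rewrite mulr_suml raddf_sum /= (bigD1 (Ordinal dN)) //=.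
rewrite pihomog_dE; last by apply: dhomogM hq; exact: pihomogP.
rewrite big1 ?addr0 // => k ne_kd.
apply: (@pihomog_ne0 _ _ _ (k + e)%N).
  by rewrite eqn_add2r; apply: contraNneq ne_kd => kd; apply/eqP/val_inj.
by apply: dhomogM hq; exact: pihomogP.
Qed.

Definition mxhomog (e : nat) a b (A : 'M[S]_(a, b)) : bool :=
  [forall k, forall l, A k l \is e.-homog].

Lemma mxhomogP e a b (A : 'M[S]_(a, b)) :
  reflect (forall k l, A k l \is e.-homog) (mxhomog e A).
Proof.
by apply: (iffP forallP) => [h k|h k]; [apply/forallP | apply/forallP].
Qed.

Lemma mxhomog_mul d e a b c (A : 'M[S]_(a, b)) (B : 'M[S]_(b, c)) :
  mxhomog d A -> mxhomog e B -> mxhomog (d + e) (A *m B).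
Proof.
move=> /mxhomogP hA /mxhomogP hB; apply/mxhomogP=> k l.
by rewrite mxE; apply: rpred_sum => j _; apply: dhomogM.
Qed.

Lemma mxhomogN d a b (A : 'M[S]_(a, b)) : mxhomog d A -> mxhomog d (- A).
Proof.
by move=> /mxhomogP hA; apply/mxhomogP => k l; rewrite mxE rpredN.
Qed.

Lemma mxhomog0 d a b : mxhomog d (0 : 'M[S]_(a, b)).
Proof. by apply/mxhomogP => k l; rewrite mxE rpred0. Qed.

Lemma mxhomog_block d a1 a2 b1 b2 (A : 'M[S]_(a1, b1)) (B : 'M_(a1, b2))
    (C : 'M_(a2, b1)) (D : 'M_(a2, b2)) :
  mxhomog d A -> mxhomog d B -> mxhomog d C -> mxhomog d D ->
  mxhomog d (block_mx A B C D).
Proof.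
move=> /mxhomogP hA /mxhomogP hB /mxhomogP hC /mxhomogP hD.
apply/mxhomogP=> k l; rewrite !mxE; case: split => ?; rewrite mxE.
  by case: split.
by case: split.
Qed.

(** Solvability row by row already gives a homogeneous solution: since B is
    homogeneous, the part of degree d of any solution is a solution. *)
Lemma homog_lift d e a b c (A : 'M[S]_(a, c)) (B : 'M[S]_(b, c)) :
  mxhomog (d + e) A -> mxhomog e B ->
  (forall k, exists w, row k A = w *m B) ->
  exists2 X : 'M_(a, b), mxhomog d X & X *m B = A.
Proof.
move=> /mxhomogP hA /mxhomogP hB sol.
have sol' k : exists w, row k A == w *m B.
  by have [w ->] := sol k; exists w.
pose w k := xchoose (sol' k).
exists (\matrix_(k, l) homog_part d (w k 0 l)).
  by apply/mxhomogP=> k l; rewrite mxE; apply: pihomogP.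
apply/matrixP=> k l.
rewrite -[RHS](@pihomog_dE _ _ (Measure.clone _ mdeg _) (d + e)%N) //.
have /eqP/rowP/(_ l) := xchooseP (sol' k); rewrite !mxE => ->.
by rewrite raddf_sum /=; apply: eq_bigr => j _; rewrite mxE pihomogM_homog.
Qed.

(** The augmented complex: the augmentation counts as the differential of
    index 0, with target S in rank 1.  Exactness at every F_i and the cone
    construction then take one form for all i. *)
Definition arank F i := if i is i'.+1 then rank F i' else 1%N.

Definition adiff F i : 'M[S]_(rank F i, arank F i) :=
  match i with 0 => aug F | i'.+1 => diff F i' end.

Definition linear_resolution (d : nat) I F :=
  [/\ forall i (k : 'I_(rank F i)), shift k = (i + d)%N,
      forall i, mxhomog (if i is 0 then d else 1) (adiff F i),
      forall p, I p <-> exists v, v *m aug F = p%:M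
    & forall i (v : 'rV_(rank F i)),
      v *m adiff F i = 0 <-> exists w, v = w *m adiff F i.+1].

(** Minimality comes for free, as a linear form has no constant term. *)
Lemma linear_resolution_minimal d I F :
  linear_resolution d I F -> minimal_graded_resolution I F.
Proof.
case=> sh hom memI exact; split; first split.
- move=> i k l m; have /mxhomogP/(_ k l)/dhomogP hA := hom i.+1.
  by move=> /hA /= ->; rewrite !sh add1n.
- move=> k l m; have /mxhomogP/(_ k l)/dhomogP hA := hom 0%N.
  by move=> /hA /= ->; rewrite !sh addn0.
- by split=> // [|i]; [exact: (exact 0%N) | exact: (exact i.+1)].
- move=> i k l; have /mxhomogP/(_ k l) hA := hom i.+1.
  by apply: dhomog_nemf_coeff hA _; rewrite mf0.
Qed.

Definition has_linres (d : nat) I := exists F, linear_resolution d I F.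

Lemma has_linres_ext d I I' : (forall p, I p <-> I' p) ->
  has_linres d I -> has_linres d I'.
Proof.
move=> eqI [F [sh hom memI exact]]; exists F; split=> // p.
by rewrite -eqI.
Qed.

Definition zero_complex (d : nat) : free_complex K n :=
  @FreeComplex K n (fun=> 0%N) (fun i _ => (i + d)%N) (fun=> 0) 0.

Lemma has_linres_zero d I : (forall p, I p <-> p = 0) -> has_linres d I.
Proof.
move=> I0; exists (zero_complex d); split=> //.
- by case=> [|i]; exact: mxhomog0.
- move=> p; rewrite I0; split=> [->|[v]].
    by exists 0; rewrite mul0mx raddf0.
  by rewrite /= mulmx0 => /matrixP/(_ 0 0); rewrite !mxE mulr1n => <-.
- case=> [|i] v; split=> _; rewrite ?thinmx0 ?mul0mx //.
  by exists 0; rewrite mul0mx.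
  by exists 0; rewrite mul0mx.
Qed.

Section Cone.
Variables (d : nat) (I J : S -> Prop) (F G : free_complex K n) (m : S).
Hypotheses (resF : linear_resolution d I F) (resG : linear_resolution 1 J G).
Hypotheses (hm : m \is d.-homog) (colon : forall p, J p <-> I (p * m)).

(** The comparison map psi lifts multiplication by m from S / J to S / I.  The
    induction keeps, besides the degree, just what makes the next lift exist:
    psi_0 = m, where J * m lies in I, and afterwards that (adiff G i) psi_i is
    a cycle of F.  The minus sign makes the block matrices of the cone compose
    to zero. *)
Lemma cone_comparison :
  exists2 psi : forall i, 'M[S]_(arank G i, arank F i), psi 0%N = m%:M &
    forall i, mxhomog (if i is 0 then d else 1) (psi i) /\
              psi i.+1 *m adiff F i = - (adiff G i *m psi i).
Proof.
have [shF homF memF exF] := resF; have [shG homG memG exG] := resG.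
have homG1 i : mxhomog 1 (adiff G i) by case: i (homG i).
pose P i (A : 'M[S]_(arank G i, arank F i)) :=
  mxhomog (if i is 0 then d else 1) A &&
  match i return 'M[S]_(arank G i, arank F i) -> bool with
  | 0 => fun A => A == m%:M
  | i'.+1 => fun A => adiff G i'.+1 *m A *m adiff F i' == 0
  end A.
pose R i (A : 'M[S]_(arank G i, arank F i))
    (B : 'M[S]_(arank G i.+1, arank F i.+1)) :=
  B *m adiff F i == - (adiff G i *m A).
have GG0 i : adiff G i.+1 *m adiff G i = 0.
  apply/row_matrixP=> k; rewrite row_mul row0.
  by apply/exG; exists (delta_mx 0 k); rewrite rowE.
have solvable i (A : 'M[S]_(arank G i, arank F i)) k : P i A ->
    exists w, row k (- (adiff G i *m A)) = w *m adiff F i.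
  case: i A k => [|i] A k /andP[_ /= /eqP PA].
    have /memF[w wE] : I (- (aug G k 0 * m)).
      rewrite -mulNr; apply/colon/memG; exists (- delta_mx 0 k).
      by rewrite mulNmx -rowE; apply/rowP=> j; rewrite !ord1 !mxE mulr1n.
    exists w; rewrite wE PA mul_mx_scalar; apply/rowP=> j.
    by rewrite !ord1 !mxE mulr1n mulrC.
  apply/exF; rewrite -row_mul mulNmx PA oppr0; exact: row0.
have [||psi psi0 psiP] :=
  @dependent_chain (fun i => 'M[S]_(arank G i, arank F i)) P R m%:M.
- rewrite /P /= eqxx andbT; apply/mxhomogP=> k l.
  by rewrite !ord1 mxE mulr1n.
- move=> i A PA; have /andP[hA _] := PA.
  have hGA : mxhomog (1 + (if i is 0 then d else 1)) (- (adiff G i *m A)).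
    exact/mxhomogN/mxhomog_mul.
  have [B hB BE] := homog_lift hGA (homF i) (fun k => solvable i A k PA).
  exists B; rewrite /R BE eqxx andbT; apply/andP; split=> //.
  by rewrite -mulmxA BE mulmxN mulmxA GG0 mul0mx oppr0.
by exists psi => // i; have [/andP[? _] /eqP ?] := psiP i.
Qed.

(** The resolution of S / J has one more term than that of J, so the summand
    S = G_(-1) generated by m sits in step 0 and G_i in step i + 1. *)
Definition cone (psi : forall i, 'M[S]_(arank G i, arank F i)) :=
  @FreeComplex K n (fun i => rank F i + arank G i)%N (fun i _ => (i + d)%N)
    (fun i => block_mx (diff F i) 0 (psi i.+1) (adiff G i))
    (col_mx (aug F) m%:M).

Lemma cone_linear_resolution (psi : forall i, 'M[S]_(arank G i, arank F i)) :
  psi 0%N = m%:M ->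
  (forall i, mxhomog (if i is 0 then d else 1) (psi i) /\
             psi i.+1 *m adiff F i = - (adiff G i *m psi i)) ->
  linear_resolution d (fun p => exists a b, I a /\ p = a + b * m) (cone psi).
Proof.
have [shF homF memF exF] := resF; have [shG homG memG exG] := resG.
move=> psi0 psiP.
have homG1 i : mxhomog 1 (adiff G i) by case: i (homG i).
split=> //.
- case=> [|i] /=.
    apply/mxhomogP=> k l; rewrite !ord1 mxE; case: split => k'.
      by have /mxhomogP := homF 0%N; apply.
    by rewrite !ord1 mxE mulr1n.
  apply: mxhomog_block; [exact: (homF i.+1) | exact: mxhomog0 | | exact: homG1].
  by have [] := psiP i.+1.
- move=> p; split=> [[a [b [/memF[v vE] ->]]]|[v]].
    exists (row_mx v b%:M); rewrite /= mul_row_col vE -scalar_mxM.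
    by rewrite raddfD.
  rewrite -[v]hsubmxK /= mul_row_col => vE.
  pose a := (lsubmx v *m aug F) 0 0; exists a, (rsubmx v 0 0); split.
    by apply/memF; exists (lsubmx v); rewrite [LHS]mx11_scalar.
  move/matrixP: vE => /(_ 0 0); rewrite [RHS]mxE mulr1n => <-.
  by rewrite mxE /a mul_mx_scalar [X in _ + X]mxE [m * _]mulrC.
- have boundary i (u : 'rV_(rank F i.+1)) (w : 'rV_(rank G i)) :
      (u *m diff F i + w *m psi i.+1) *m adiff F i
        + w *m adiff G i *m psi i = 0.
    have -> : (u *m diff F i + w *m psi i.+1) *m adiff F i
              = - (w *m adiff G i *m psi i).
      rewrite mulmxDl -(mulmxA w (psi i.+1)) (psiP i).2 mulmxN mulmxA.
      by rewrite (_ : u *m diff F i *m _ = 0) ?add0r //; apply/exF; exists u.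
    by rewrite addNr.
  have lift_cycle i (u : 'rV_(rank F i)) (w : 'rV_(rank G i)) :
      u *m adiff F i + w *m adiff G i *m psi i = 0 ->
      exists u', u = u' *m diff F i + w *m psi i.+1.
    move=> cyc; have /exF[u' u'E] : (u - w *m psi i.+1) *m adiff F i = 0.
      by rewrite mulmxBl -(mulmxA w (psi i.+1)) (psiP i).2 mulmxN mulmxA opprK.
    by exists u'; rewrite -u'E subrK.
  case=> [|i] v /=; rewrite -[v]hsubmxK.
  + rewrite mul_row_col; split=> [cyc|[w]].
      have memI : I (rsubmx v 0 0 * m).
        apply/memF; exists (- lsubmx v); rewrite mulNmx.
        move/eqP: cyc; rewrite addr_eq0 => /eqP ->; rewrite opprK.
        rewrite mul_mx_scalar; apply/rowP=> j.
        by rewrite !ord1 !mxE mulr1n mulrC.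
      have [w wE] := (memG _).1 ((colon _).2 memI).
      have rE : rsubmx v = w *m adiff G 0%N by rewrite [LHS]mx11_scalar -wE.
      have [|u uE] := lift_cycle 0%N (lsubmx v) w; first by rewrite -rE psi0.
      by exists (row_mx u w); rewrite mul_row_block mulmx0 add0r -uE -rE.
    rewrite -[w]hsubmxK mul_row_block mulmx0 add0r => /eq_row_mx[-> ->].
    by rewrite -psi0; exact: (boundary 0%N).
  rewrite mul_row_block mulmx0 add0r; split=> [cyc|[w]].
    rewrite -row_mx0 in cyc; have [cycF /(exG i)[w rE]] := eq_row_mx cyc.
    have [|u uE] := lift_cycle i.+1 (lsubmx v) w; first by rewrite -rE.
    by exists (row_mx u w); rewrite mul_row_block mulmx0 add0r -uE -rE.
  rewrite -[w]hsubmxK mul_row_block mulmx0 add0r => /eq_row_mx[-> ->].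
  have := boundary i.+1 (lsubmx w) (rsubmx w) => /= ->.
  rewrite (_ : _ *m _ *m adiff G i = 0) ?row_mx0 //.
  by apply/exG; exists (rsubmx w).
Qed.

End Cone.

(** The mapping cone step: if J = I : m, then (I + (m)) / I is S / J shifted
    by the degree of m. *)
Lemma has_linres_add d I J m :
  has_linres d I -> has_linres 1 J -> m \is d.-homog ->
  (forall p, J p <-> I (p * m)) ->
  has_linres d (fun p => exists a b, I a /\ p = a + b * m).
Proof.
move=> [F resF] [G resG] hm colon.
have [psi psi0 psiP] := cone_comparison resF resG hm colon.
by exists (cone d m psi); apply: (cone_linear_resolution resF resG).
Qed.
End Resolutions.

(** * Monomial ideals with linear quotients *)

Section MonomialIdeals.
Import GRing.Theory.
Local Open Scope ring_scope.
Variables (K : fieldType) (n : nat).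
Local Notation S := {mpoly K[n]}.
Implicit Types (p q : S) (t m : 'X_{1..n}) (s : seq 'X_{1..n}).

Definition divides_some s m := has (fun t => (t <= m)%MM) s.

(** Membership in a monomial ideal is read off the support, which makes the
    colon ideals below purely combinatorial. *)
Definition monomial_ideal s p : bool := all (divides_some s) (msupp p).

Lemma monomial_ideal_nil p : monomial_ideal [::] p <-> p = 0.
Proof.
rewrite /monomial_ideal; split=> [|->]; last by rewrite msupp0.
by case E: (msupp p) => [|m ms] //= _; exact: msuppnil0.
Qed.

Lemma monomial_ideal_cons t s p :
  monomial_ideal (t :: s) p <->
  exists a b, monomial_ideal s a /\ p = a + b * 'X_[t].
Proof.
split=> [/allP sp|[a [b [/allP sa ->]]]]; last first.
  apply/allP=> m /msuppD_le; rewrite mem_cat => /orP[/sa|].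
    by rewrite /divides_some /= orbC => ->.
  rewrite (perm_mem (msuppMX _ _)) => /mapP[m' _ ->].
  by rewrite /divides_some /= lem_addr.
exists (\sum_(m <- msupp p | divides_some s m) p@_m *: 'X_[m]).
exists (\sum_(m <- msupp p | ~~ divides_some s m) p@_m *: 'X_[m - t]).
split.
  apply/allP=> m; rewrite mcoeff_msupp raddf_sum /= => nz.
  have [//|sm] := boolP (divides_some s m); case/negP: nz.
  rewrite big1 // => m' sm'; rewrite mcoeffZ mcoeffX.
  by case: eqP => [m'm|_]; [rewrite m'm (negbTE sm) in sm' | rewrite mulr0].
rewrite {1}[p]mpolyE (bigID (divides_some s)) /=; congr (_ + _).
rewrite mulr_suml [LHS]big_seq_cond [RHS]big_seq_cond.
apply: eq_bigr => m /andP[/sp].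
rewrite /divides_some /= => /orP[tm _|->//].
by rewrite -scalerAl -mpolyXD submK.
Qed.

Lemma ideal_gen_cons (f : S) (fs : seq S) p :
  ideal_gen (f :: fs) p <-> exists a b, ideal_gen fs a /\ p = a + b * f.
Proof.
split=> [[c ->]|[a [b [[c ->] ->]]]].
  exists (\sum_(i < size fs) c (lift ord0 i) * fs`_i), (c ord0).
  by split; [exists (fun i => c (lift ord0 i)) | rewrite big_ord_recl addrC].
exists (fun i => if unlift ord0 i is Some j then c j else b).
rewrite big_ord_recl unlift_none addrC; congr (_ + _).
by apply: eq_bigr => i _; rewrite liftK.
Qed.

Lemma ideal_gen_monomials s p :
  ideal_gen [seq 'X_[t] | t <- s] p <-> monomial_ideal s p.
Proof.
elim: s p => [|t s IHs] p /=.
  rewrite monomial_ideal_nil; split=> [[c ->]|->]; first by rewrite big_ord0.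
  by exists (fun=> 0); rewrite big_ord0.
rewrite ideal_gen_cons monomial_ideal_cons.
by split=> [] [a [b [/IHs ? ->]]]; exists a, b.
Qed.

Lemma monomial_colon s s' t :
  (forall m, divides_some s (m + t)%MM = divides_some s' m) ->
  forall p, monomial_ideal s' p <-> monomial_ideal s (p * 'X_[t]).
Proof.
move=> ss' p; rewrite /monomial_ideal.
rewrite [in X in _ <-> X](perm_all _ (msuppMX _ _)).
rewrite (all_map (fun m => (t + m)%MM)).
rewrite (@eq_all _ (preim _ _) (divides_some s')) // => m /=.
by rewrite addmC ss'.
Qed.

Lemma has_linres_monomial_cons d s s' t :
  has_linres d (monomial_ideal s) -> has_linres 1 (monomial_ideal s') ->
  mdeg t = d ->
  (forall m, divides_some s (m + t)%MM = divides_some s' m) ->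
  has_linres d (monomial_ideal (t :: s)).
Proof.
move=> ress ress' td ss'.
have ht : ('X_[t] : S) \is d.-homog by rewrite dhomogX; apply/eqP.
have := has_linres_add ress ress' ht (monomial_colon ss').
by apply: has_linres_ext => p; rewrite monomial_ideal_cons.
Qed.

(** A variable outside a set of variables is a nonzerodivisor modulo the ideal
    that they generate, so each step is a cone over the complex built
    so far. *)
Lemma has_linres_variables (xs : seq 'I_n) :
  uniq xs -> has_linres 1 (monomial_ideal [seq U_(x)%MM | x <- xs]).
Proof.
elim: xs => [_|x xs IHxs /andP[xNxs /IHxs res]].
  by apply: has_linres_zero => p; rewrite monomial_ideal_nil.
apply: (has_linres_monomial_cons res res (mdeg1 x)) => m.
rewrite /divides_some !has_map; apply: eq_in_has => y yxs /=.
rewrite !lep1mP mnmDE mnm1E; case: (x =P y) => [xy|_]; last by rewrite addn0.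
by rewrite xy yxs in xNxs.
Qed.

Definition squarefree (A : {set 'I_n}) : 'X_{1..n} :=
  [multinom (i \in A : nat) | i < n].

Lemma edge_monomialE A : edge_monomial K A = 'X_[squarefree A].
Proof.
rewrite mpolyXE_id /edge_monomial big_mkcond /=; apply: eq_bigr => i _.
by rewrite mnmE; case: (i \in A); rewrite ?expr1 ?expr0.
Qed.

Lemma mdeg_squarefree (A : {set 'I_n}) : mdeg (squarefree A) = #|A|.
Proof.
rewrite mdegE -sum1_card [RHS]big_mkcond; apply: eq_bigr => i _.
by rewrite mnmE; case: (i \in A).
Qed.

Lemma squarefree_leP (A : {set 'I_n}) m :
  reflect (forall x, x \in A -> (0 < m x)%N) (squarefree A <= m)%MM.
Proof.
apply: (iffP mnm_lepP) => [Am x xA|Am x].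
  by have := Am x; rewrite mnmE xA.
by rewrite mnmE; case: (boolP (x \in A)) => // /Am.
Qed.

(** The head of the list is the generator added last.  For squarefree
    monomials the colon ideal by x_A is generated by the monomials x_(B \ A);
    it is generated by variables when each B \ A contains a point x such that
    some C \ A equals {x}. *)
Fixpoint linear_quotients (As : seq {set 'I_n}) : Prop :=
  if As is A :: As' then
    (forall B : {set 'I_n}, B \in As' -> exists x (C : {set 'I_n}),
       [/\ x \in B, x \notin A, C \in As' & C \subset x |: A])
    /\ linear_quotients As'
  else True.

Lemma has_linres_linear_quotients d As :
  linear_quotients As -> uniq As -> {in As, forall A : {set 'I_n}, #|A| = d} ->
  has_linres d (monomial_ideal [seq squarefree A | A <- As]).
Proof.
elim: As => [_ _ _|A As IHAs [colonA lqAs] /andP[ANAs uAs] dAs].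
  by apply: has_linres_zero => p; rewrite monomial_ideal_nil.
have {}IHAs : has_linres d (monomial_ideal [seq squarefree A | A <- As]).
  by apply: IHAs => // B BAs; rewrite dAs // inE BAs orbT.
pose colon_vars := [seq x <- enum 'I_n |
  (x \notin A) && has (fun C : {set 'I_n} => C \subset x |: A) As].
have uvars : uniq colon_vars by rewrite filter_uniq ?enum_uniq.
apply: (has_linres_monomial_cons IHAs (has_linres_variables uvars)).
  by rewrite mdeg_squarefree dAs ?mem_head.
move=> m; rewrite /divides_some !has_map; apply/hasP/hasP => /=.
  move=> [B BAs /squarefree_leP Bm].
  have [x [C [xB xNA CAs CxA]]] := colonA B BAs.
  exists x.
    by rewrite /colon_vars mem_filter mem_enum xNA andbT; apply/hasP; exists C.
  have := Bm x xB; rewrite mnmDE mnmE (negbTE xNA) addn0 lep1mP.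
  by rewrite lt0n.
move=> [x]; rewrite /colon_vars mem_filter.
move=> /andP[/andP[xNA /hasP[C CAs CxA]] _].
rewrite /= lep1mP => mx; exists C => //=.
apply/squarefree_leP => y /(subsetP CxA); rewrite !inE mnmDE mnmE.
case/orP=> [/eqP ->|->]; first by rewrite addn_gt0 lt0n mx.
by rewrite addn1.
Qed.

Lemma edge_ideal_monomial (C : {set {set 'I_n}}) As p : As =i C ->
  edge_ideal K C p <-> monomial_ideal [seq squarefree A | A <- As] p.
Proof.
move=> AsC; rewrite /edge_ideal.
rewrite (eq_map edge_monomialE) (map_comp (fun t => 'X_[t]) squarefree).
rewrite ideal_gen_monomials /monomial_ideal.
rewrite (@eq_all _ (divides_some [seq squarefree A | A <- enum C])
                   (divides_some [seq squarefree A | A <- As])) // => m.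
rewrite /divides_some !has_map; apply: eq_has_r => A.
by rewrite mem_enum AsC.
Qed.

Lemma has_linear_resolution_edge_ideal d (C : {set {set 'I_n}}) As :
  As =i C -> linear_quotients As -> uniq As ->
  {in C, forall A : {set 'I_n}, #|A| = d} ->
  has_linear_resolution (edge_ideal K C).
Proof.
move=> AsC lqAs uAs dC.
have dAs : {in As, forall A : {set 'I_n}, #|A| = d}.
  by move=> A; rewrite AsC; exact: dC.
have [F resF] : has_linres d (edge_ideal K C).
  apply: has_linres_ext (has_linres_linear_quotients lqAs uAs dAs) => p.
  exact: iff_sym (edge_ideal_monomial p AsC).
right; exists d.
  exists [seq edge_monomial K A | A <- enum C] => //.
  apply/allP=> f /mapP[A]; rewrite mem_enum => /dC Ad ->.
  by rewrite edge_monomialE dhomogX; apply/eqP; rewrite /= mdeg_squarefree.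
exists (fun i j => #|[set k : 'I_(rank F i) | shift k == j]|).
  by exists F; first exact: linear_resolution_minimal resF.
move=> i j ne_j; have [shF _ _ _] := resF.
apply/eqP; rewrite cards_eq0; apply/eqP/setP=> k; rewrite !inE shF.
by rewrite eq_sym (negbTE ne_j).
Qed.
End MonomialIdeals.

(** * Connected subsets of a cycle *)

Section CycleEnds.
Variable n : nat.
Implicit Types (x y z w e f t : 'I_n) (S T U : {set 'I_n}).

(** Ends count the maximal arcs of a proper subset of the cycle. *)
Definition is_end U x := (x \in U) && (ordS x \notin U).

Lemma ordS_small x : x.+1 < n -> ordS x = x.+1 :> nat.
Proof. exact: modn_small. Qed.

Lemma ordS_last x : x.+1 = n -> ordS x = 0 :> nat.
Proof. by move=> xn; rewrite /= xn modnn. Qed.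

Lemma cycle_graphE x y : cycle_graph n x y = (y == ordS x) || (x == ordS y).
Proof. by rewrite /cycle_graph !(modn_small (ltn_ord _)). Qed.

Lemma connect_induced_sym U : connect_sym (induced (cycle_graph n) U).
Proof.
apply: sym_connect_sym => x y.
by rewrite /induced /= cycle_graph_sym andbCA.
Qed.

Lemma iter_ordS x k : iter k (@ordS n) x = (x + k) %% n :> nat.
Proof.
elim: k => [|k IHk]; first by rewrite addn0 modn_small.
by rewrite iterS /= IHk -[_.+1]addn1 modnDml addn1 addnS.
Qed.

Lemma ordS_reaches x y : exists k, iter k (@ordS n) x = y.
Proof.
exists (y + (n - x)); apply: val_inj; rewrite /= iter_ordS.
have -> : x + (y + (n - x)) = y + n by have := ltn_ord x; lia.
by rewrite modnDr modn_small.
Qed.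

Lemma connect_walk U x k :
  x \in U -> (forall j, j < k -> ~~ is_end U (iter j (@ordS n) x)) ->
  connect (induced (cycle_graph n) U) x (iter k (@ordS n) x).
Proof.
move=> xU noend.
suff /(_ k (leqnn k))/andP[] : forall i, i <= k ->
    (iter i (@ordS n) x \in U) &&
    connect (induced (cycle_graph n) U) x (iter i (@ordS n) x) by [].
elim=> [|i IHi] ik; first by rewrite xU connect0.
have /andP[iU xi] := IHi (ltnW ik).
have := noend i ik; rewrite /is_end iU negbK -iterS => SiU.
rewrite SiU; apply: connect_trans xi (connect1 _).
by rewrite /induced /= iU SiU cycle_graphE eqxx.
Qed.

(** The vertices of U in the interval ]e, f] are separated from the rest of U,
    because the successors of e and of f are missing. *)
Lemma two_ends_disconnected U e f :
  is_end U e -> is_end U f -> e < f ->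
  ~~ induced_connected (cycle_graph n) U.
Proof.
move=> /andP[eU SeU] /andP[fU SfU] ef; apply/negP=> /andP[_ /forallP conn].
pose a := [pred x : 'I_n | e < x <= f].
have clos : closed (induced (cycle_graph n) U) a.
  apply: (intro_closed (@connect_induced_sym U)) => x y /and3P[xU yU].
  rewrite cycle_graphE !inE => /orP[]/eqP xy /andP[ex xf].
    have {}xf : x < f.
      rewrite ltn_neqAle xf andbT; apply: contra SfU => /eqP/val_inj <-.
      by rewrite -xy.
    have := ordS_small (leq_ltn_trans xf (ltn_ord f)); rewrite -xy => ->.
    by rewrite xf ltnS ltnW.
  have [yn|yn] := ltnP y.+1 n; last first.
    have := @ordS_last y; rewrite -xy => x0.
    by have := ltn_ord y; lia.
  have := ordS_small yn; rewrite -xy => xE.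
  have ne_ey : e != y by apply: contraNneq SeU => ->; rewrite -xy.
  by have : e != y :> nat by []; lia.
have /implyP/(_ eU)/forallP/(_ f)/implyP/(_ fU)/(closed_connect clos) := conn e.
by rewrite !inE ltnn ef leqnn.
Qed.

(** Conversely, walking forward from any vertex stays in U until the first
    end; when there is only one end, all vertices reach it.  When there is none,
    U is the whole cycle and the walk reaches everything. *)
Lemma connectedP U : U != set0 ->
  reflect (forall e f, is_end U e -> is_end U f -> e = f)
          (induced_connected (cycle_graph n) U).
Proof.
move=> U0; apply: (iffP idP) => [conn e f eE fE|uniq_end].
  apply/val_inj; apply/eqP; rewrite eqn_leq leqNgt [f <= e]leqNgt.
  apply/andP; split; apply/negP.
    by move=> /(two_ends_disconnected fE eE); rewrite conn.
  by move=> /(two_ends_disconnected eE fE); rewrite conn.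
rewrite /induced_connected U0 /=.
apply/forallP=> x; apply/implyP=> xU; apply/forallP=> y; apply/implyP=> yU.
have [/existsP[e eE]|/existsPn noend] := boolP [exists e, is_end U e].
  have to_e z : z \in U -> connect (induced (cycle_graph n) U) z e.
    move=> zU; have ex_k : exists k, is_end U (iter k (@ordS n) z).
      by have [k kE] := ordS_reaches z e; exists k; rewrite kE.
    case: (ex_minnP ex_k) => k kE kmin; rewrite -(uniq_end _ _ kE eE).
    apply: connect_walk => // j jk; apply/negP=> /kmin.
    by rewrite leqNgt jk.
  apply: connect_trans (to_e x xU) _.
  by rewrite connect_induced_sym to_e.
have [k <-] := ordS_reaches x y.
by apply: connect_walk => // j _; exact: noend.
Qed.

Lemma disconnected_ends U : U != set0 ->
  ~~ induced_connected (cycle_graph n) U ->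
  exists e f, [/\ is_end U e, is_end U f & e != f].
Proof.
move=> U0 dis; have /existsP[e /existsP[f /and3P[? ? ?]]] :
    [exists e, exists f, [&& is_end U e, is_end U f & e != f]].
  apply: contraNT dis => /existsPn none; apply/connectedP => // e f eE fE.
  have := none e; rewrite negb_exists => /forallP/(_ f).
  by rewrite eE fE /= negbK => /eqP.
by exists e, f.
Qed.

Lemma walk_without_ends U x y : x \in U -> x <= y ->
  (forall z, x <= z -> z < y -> ~~ is_end U z) -> y \in U.
Proof.
move=> xU xy noend.
suff H k : forall z, z = x + k :> nat -> z <= y -> z \in U.
  by apply: (H (y - x)); rewrite ?subnKC.
elim: k => [|k IHk] z zE zy.
  by have -> : z = x by apply: val_inj; rewrite /= zE addn0.
have ltk : x + k < n by have := ltn_ord z; lia.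
have zk : (Ordinal ltk).+1 < n by have := ltn_ord z; move=> /=; lia.
have kU : Ordinal ltk \in U by apply: IHk => //=; lia.
have -> : z = ordS (Ordinal ltk).
  by apply: val_inj; rewrite [RHS]ordS_small //= zE addnS.
have := noend (Ordinal ltk); rewrite /is_end kU negbK; apply=> /=; lia.
Qed.

End CycleEnds.

(** * The lexicographic order on sets *)

Section LexOrder.
Variable n : nat.
Implicit Types (A B C : {set 'I_n}).

(** On sets of equal size this is the lexicographic order of the increasing
    enumerations: the first point of difference belongs to the earlier set. *)
Definition lex_before A B :=
  [exists w : 'I_n, [&& w \in A, w \notin B &
     [forall j : 'I_n, (j < w) ==> ((j \in A) == (j \in B))]]].

Lemma lex_beforeP A B :
  reflect (exists w : 'I_n, [/\ w \in A, w \notin B &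
             forall j : 'I_n, j < w -> (j \in A) = (j \in B)])
          (lex_before A B).
Proof.
apply: (iffP existsP) => [[w /and3P[wA wB /forallP h]]|[w [wA wB h]]].
  by exists w; split=> // j jw; apply/eqP; have /implyP := h j; apply.
exists w; rewrite wA wB /=; apply/forallP=> j; apply/implyP=> jw.
by rewrite h.
Qed.

Lemma lex_before_irr A : lex_before A A = false.
Proof. by apply/lex_beforeP=> -[w [wA]]; rewrite wA. Qed.

Lemma lex_before_trans : transitive lex_before.
Proof.
move=> B A C /lex_beforeP[w [wA wB AB]] /lex_beforeP[v [vB vC BC]].
apply/lex_beforeP; have [wv|vw|wv] := ltngtP w v.
- exists w; rewrite wA -(BC w wv); split=> // j jw.
  by rewrite AB // BC // (ltn_trans jw).
- exists v; rewrite vC (AB v vw); split=> // j jv.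
  by rewrite AB ?BC // (ltn_trans jv).
- by rewrite (val_inj wv) vB in wB.
Qed.

Lemma lex_before_total A B : A != B -> lex_before A B || lex_before B A.
Proof.
move=> neAB; have [w0 w0P] : exists w, (w \in A) != (w \in B).
  apply/existsP; apply: contraR neAB => /existsPn h.
  by apply/eqP/setP=> x; apply/eqP; rewrite -[_ == _]negbK h.
case: (@arg_minnP _ w0 (fun w => (w \in A) != (w \in B)) val w0P) => w wP wmin.
have same (j : 'I_n) : j < w -> (j \in A) = (j \in B).
  by move=> jw; apply: contraTeq jw => /wmin; rewrite -leqNgt.
case wA: (w \in A); case wB: (w \in B); rewrite ?wA ?wB // in wP.
  by apply/orP; left; apply/lex_beforeP; exists w; rewrite wA wB.
apply/orP; right; apply/lex_beforeP; exists w; rewrite wA wB; split=> // j jw.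
by rewrite same.
Qed.

Lemma lex_sortedP (D : {set {set 'I_n}}) :
  exists2 As : seq {set 'I_n}, As =i D /\ uniq As &
    pairwise (fun A B => lex_before B A) As.
Proof.
pose le A B := (A == B) || lex_before B A.
have le_total : total le.
  move=> A B; rewrite /le eq_sym.
  by have [//|/lex_before_total/orP[] ->] := eqVneq B A; rewrite ?orbT.
have le_trans : transitive le.
  move=> B A C /orP[/eqP->//|BA] /orP[/eqP <-|CB]; rewrite /le ?BA ?orbT //.
  by rewrite (lex_before_trans CB BA) orbT.
have us : uniq (sort le (enum D)) by rewrite sort_uniq enum_uniq.
exists (sort le (enum D)); first by split=> // A; rewrite mem_sort mem_enum.
have := sort_sorted le_total (enum D); rewrite sorted_pairwise // => ple.
have := us; rewrite uniq_pairwise => pne.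
have : pairwise [rel A B | le A B && (A != B)] (sort le (enum D)).
  by rewrite pairwise_relI ple pne.
apply: sub_pairwise => A B /andP[]; rewrite /le /=.
by case: eqVneq.
Qed.

(** In the exchange hypothesis C ranges over the whole list; as C comes before
    A, it automatically belongs to the part that A is compared with. *)
Lemma linear_quotients_lex As : pairwise (fun A B => lex_before B A) As ->
  (forall A B, A \in As -> B \in As -> lex_before B A ->
     exists x C, [/\ x \in B, x \notin A, C \in As, C \subset x |: A
                   & lex_before C A]) ->
  linear_quotients As.
Proof.
elim: As => [//|A As IHAs] /= /andP[/allP ltA ltAs] exch; split.
  move=> B BAs; have [|||x [C [xB xA CAs CxA CA]]] := exch A B.
  - exact: mem_head.
  - by rewrite inE BAs orbT.
  - exact: ltA.
  exists x, C; split=> //; move: CAs; rewrite inE => /orP[/eqP CeA|//].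
  by rewrite CeA lex_before_irr in CA.
apply: IHAs => // A1 B A1As BAs BA1.
have [||//|x [C [xB xA CAs CxA CA]]] := exch A1 B.
- by rewrite inE A1As orbT.
- by rewrite inE BAs orbT.
exists x, C; split=> //; move: CAs; rewrite inE => /orP[/eqP CeA|//].
have := lex_before_trans CA (ltA A1 A1As).
by rewrite CeA lex_before_irr.
Qed.

End LexOrder.

(** * The exchange property of non-arcs *)

Section Exchange.
Variable n : nat.
Implicit Types (x y z w e f t : 'I_n) (S T U : {set 'I_n}).

Lemma card_swap S x y : y \in S -> x \notin S -> #|x |: (S :\ y)| = #|S|.
Proof.
by move=> yS xS; rewrite cardsU1 !inE negb_and xS orbT (cardsD1 y S) yS.
Qed.

Lemma lex_before_swap S x y : x \notin S -> x < y ->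
  lex_before (x |: (S :\ y)) S.
Proof.
move=> xS xy; apply/lex_beforeP; exists x; split; rewrite ?setU11 // => j jx.
by rewrite !inE -!val_eqE /= (ltn_eqF jx) (ltn_eqF (ltn_trans jx xy)).
Qed.

(** The successors of two distinct ends are two missing vertices. *)
Lemma disconnected_card T : T != set0 ->
  ~~ induced_connected (cycle_graph n) T -> #|T|.+2 <= n.
Proof.
move=> T0 Tdis.
suff : 2 <= #|~: T| by have := cardsC T; rewrite card_ord; lia.
have [//|le1] := leqP 2 #|~: T|; case/negP: Tdis; apply/connectedP => // e f.
move=> /andP[_ eT] /andP[_ fT].
have ordS_inj : injective (@ordS n) by apply: (can_inj (@ordSK n)).
apply: ordS_inj; apply/eqP; rewrite -[_ == _]negbK; apply: contraTN le1 => ne.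
rewrite -leqNgt; apply: leq_trans (_ : #|[set ordS e; ordS f]| <= _).
  by rewrite cards2 ne.
by apply/subset_leq_card/subsetP=> x; rewrite !inE => /orP[]/eqP ->.
Qed.

(** A connected set that contains 0 and not the last vertex cannot wrap around:
    its maximum is its only end. *)
Lemma initial_segment U (x0 last : 'I_n) :
  x0 = 0 :> nat -> last.+1 = n ->
  x0 \in U -> last \notin U -> induced_connected (cycle_graph n) U ->
  exists2 e : 'I_n, e < last & U = [set z : 'I_n | z <= e].
Proof.
move=> x0E lastE x0U lastU Uconn.
have U0 : U != set0 by apply/set0Pn; exists x0.
have /(connectedP U0) uniq_end := Uconn.
case: (@arg_maxnP _ x0 (mem U) val x0U) => e /= eU emax.
have e_last : e < last.
  have ne : e != last :> nat.
    by apply: contraNneq lastU => /val_inj <-.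
  by have := ltn_ord e; lia.
exists e => //; apply/setP=> z; rewrite inE; apply/idP/idP=> [/emax //|ze].
have eE : is_end U e.
  rewrite /is_end eU /=; apply/negP=> /emax /=; rewrite modn_small; lia.
apply: (@walk_without_ends _ U x0) => //; first by rewrite x0E.
move=> v _ vz; apply/negP=> /(uniq_end _ _ eE) ev.
by move: ze; rewrite ev leqNgt vz.
Qed.

Lemma card_initial_segment e : #|[set z : 'I_n | z <= e]| = e.+1.
Proof.
rewrite cardsE -sum1_card -(big_ord_widen _ (fun=> 1) (ltn_ord e)).
by rewrite sum_nat_const card_ord muln1.
Qed.

(** Let w be the first point of difference.  The three candidates tried in turn
    are S - y + w for y the least element of S above w, S - last + w, and, when
    both of these are arcs, S - last + t for t the element of T above w.  An arc
    is determined by its only end, so the first failure forces S to contain the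
    last vertex and [0, w[, the second one that S - last + w is an initial
    segment; together they give S = [0, w[ + {w + 1, last}. *)
Lemma lex_exchange S T : 2 < #|S| -> #|T| = #|S| ->
  ~~ induced_connected (cycle_graph n) T -> lex_before T S ->
  exists x (C : {set 'I_n}), [/\ x \in T, x \notin S & C \subset x |: S] /\
    [/\ #|C| = #|S|, ~~ induced_connected (cycle_graph n) C & lex_before C S].
Proof.
move=> d_ge3 dT Tdis /lex_beforeP[w [wT wS same]].
have T0 : T != set0 by apply/set0Pn; exists w.
have dn : #|S|.+2 <= n by rewrite -dT disconnected_card.
have n_gt0 : 0 < n := leq_ltn_trans (leq0n w) (ltn_ord w).
pose x0 : 'I_n := Ordinal n_gt0.
have last_lt : n.-1 < n by rewrite ltn_predL.
pose last : 'I_n := Ordinal last_lt.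
have lastE : last.+1 = n := prednK n_gt0.
have swap y : y \in S -> w < y ->
    ~~ induced_connected (cycle_graph n) (w |: (S :\ y)) ->
    exists x (C : {set 'I_n}), [/\ x \in T, x \notin S & C \subset x |: S] /\
      [/\ #|C| = #|S|, ~~ induced_connected (cycle_graph n) C & lex_before C S].
  move=> yS wy Udis; exists w, (w |: (S :\ y)); split; split=> //.
  - by apply: setUS; apply: subD1set.
  - exact: card_swap.
  - exact: lex_before_swap.
have [y0 y0S] : exists y, (y \in S) && (w < y).
  apply/existsP; apply: contraT => /existsPn below.
  have ST : S \subset T.
    apply/subsetP=> z zS; have := below z; rewrite zS /= -leqNgt leq_eqVlt.
    case/orP=> [/eqP/val_inj zw|/same -> //]; by rewrite -zw zS in wS.
  have /eqP ST' : S == T by rewrite eqEcard ST dT leqnn.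
  by rewrite ST' wT in wS.
case: (@arg_minnP _ y0 (fun y => (y \in S) && (w < y)) val y0S) =>
  y /andP[yS wy] ymin {y0 y0S}.
have {}ymin z : z \in S -> w < z -> y <= z.
  by move=> zS wz; apply: ymin; rewrite zS.
pose U1 := w |: (S :\ y).
have wU1 : w \in U1 by rewrite setU11.
have [U1conn|] := boolP (induced_connected (cycle_graph n) U1);
  last exact: swap.
have U10 : U1 != set0 by apply/set0Pn; exists w.
have /(connectedP U10) uniq1 := U1conn.
have w_lt : w.+1 < n := leq_ltn_trans wy (ltn_ord y).
have wE : is_end U1 w.
  rewrite /is_end wU1 !inE -!val_eqE /= modn_small // gtn_eqF //=.
  apply/negP=> /andP[ne_y /ymin]; rewrite /= modn_small // ltnSn => /(_ isT) yw.
  by case/eqP: ne_y; apply/eqP; rewrite eqn_leq wy yw.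
(* S has a second element above w: otherwise U1 would be contained in T, hence
   equal to it, although U1 is connected and T is not. *)
have [x /and3P[xS wx ne_xy]] : exists x, [&& x \in S, w < x & x != y].
  apply/existsP; apply: contraT => /existsPn below.
  have U1T : U1 \subset T.
    apply/subsetP=> z; rewrite !inE => /orP[/eqP -> //|/andP[zy zS]].
    have := below z; rewrite zS zy andbT /= -leqNgt leq_eqVlt.
    by case/orP=> [/eqP/val_inj -> //|/same ->].
  have U1E : U1 == T by rewrite eqEcard U1T dT card_swap /=.
  by rewrite -(eqP U1E) U1conn in Tdis.
have above1 z (v : 'I_n) : z \in S -> w < z -> z != y -> z <= v -> v \in U1.
  move=> zS wz ne_zy zv; apply: (@walk_without_ends _ U1 z) => // [|u zu _].
    by rewrite !inE ne_zy zS orbT.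
  by apply/negP=> /(uniq1 _ _ wE) wu; move: zu; rewrite -wu leqNgt wz.
have w_last : w < last by rewrite -ltnS lastE.
have x_last : x <= last by rewrite -ltnS lastE.
have lastU1 : last \in U1 by exact: above1 xS wx ne_xy x_last.
have lastS : last \in S.
  by move: lastU1; rewrite !inE -[last == w]val_eqE gtn_eqF //= => /andP[].
(* The arc U1 ends at w, so it wraps around through the last vertex. *)
have x0U1 : x0 \in U1.
  have : ~~ is_end U1 last.
    by apply/negP=> /(uniq1 _ _ wE) wl; move: w_last; rewrite -wl ltnn.
  rewrite /is_end lastU1 negbK (_ : ordS last = x0) //.
  by apply: val_inj; rewrite [LHS]ordS_last.
pose U2 := w |: (S :\ last).
have [U2conn|] := boolP (induced_connected (cycle_graph n) U2);
  last exact: swap.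
have x0U2 : x0 \in U2.
  move: x0U1; rewrite !inE => /orP[-> //|/andP[_ ->]].
  rewrite andbT -[x0 == last]val_eqE /=; apply/orP; right.
  by rewrite eq_sym -lt0n (leq_ltn_trans (leq0n w) w_last).
have lastU2 : last \notin U2.
  by rewrite !inE -[last == w]val_eqE gtn_eqF //= eqxx.
have [e e_last U2E] :=
  initial_segment (erefl : x0 = 0 :> nat) lastE x0U2 lastU2 U2conn.
have cardU2 : e.+1 = #|S|.
  rewrite -(card_swap lastS wS) -/U2 U2E.
  by apply/esym; exact: card_initial_segment.
have memU2 z : (z <= e) = (z == w) || (z != last) && (z \in S).
  by have /setP/(_ z) := U2E; rewrite !inE.
(* A further element z < last of S would make U1 contain e + 1, the vertex
   that follows the initial segment U2.  As e + 1 = #|S| <= n - 2, this vertex is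
   not the last one, so it would belong to U2. *)
have above_last z : z \in S -> w < z -> z != y -> z = last.
  move=> zS wz ne_zy; apply/eqP; apply: contraT => ne_zl.
  have ze : z <= e by rewrite memU2 ne_zl zS orbT.
  have u_lt : e.+1 < n by rewrite -[X in _ < X]lastE ltnS.
  pose u : 'I_n := Ordinal u_lt.
  have : u \in U1 by apply: above1 zS wz ne_zy _; rewrite /= ltnW.
  have ne_uw : u != w.
    by rewrite -val_eqE gtn_eqF //= ltnS (leq_trans _ ze) // ltnW.
  have ne_ul : u != last.
    by rewrite -val_eqE ltn_eqF // -ltnS lastE /= cardU2.
  rewrite !inE (negbTE ne_uw) /= => /andP[_ uS].
  by have := memU2 u; rewrite ne_ul uS orbT /= ltnn.
have ne_yl : y < last.
  rewrite (leq_trans _ x_last) // ltn_neqAle ymin // andbT.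
  by apply: contra ne_xy => /eqP/val_inj ->.
have ye : y <= e by rewrite memU2 yS -[y == last]val_eqE ltn_eqF ?orbT.
have {ye} yE : y = e.
  apply/eqP; apply: contraT => ne_ye.
  have lt_ye : y < e by rewrite ltn_neqAle ye andbT.
  have := memU2 e; rewrite leqnn => /esym/orP[/eqP ew|/andP[ne_el eS]].
    by move: lt_ye; rewrite ew ltnNge ltnW.
  have := above_last e eS (ltn_trans wy lt_ye); rewrite eq_sym => /(_ ne_ye) el.
  by rewrite el eqxx in ne_el.
have yw1 : y = w.+1 :> nat.
  apply/eqP; rewrite eqn_leq wy andbT leqNgt; apply/negP=> lt_wy.
  pose v : 'I_n := Ordinal w_lt.
  have := memU2 v; rewrite -yE (ltnW lt_wy) => /esym/orP[|/andP[ne_vl vS]].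
    by rewrite -val_eqE gtn_eqF /=.
  have vl : v = last by apply: above_last; rewrite // -val_eqE ltn_eqF.
  by rewrite vl eqxx in ne_vl.
have wd : w.+2 = #|S| by rewrite -cardU2 -yE yw1.
have S_cases z : z \in S -> [\/ z < w, z = y | z = last].
  move=> zS; have [zw|wz|zw] := ltngtP z w; first by constructor.
    have [->|ne_zy] := eqVneq z y; first by constructor 2.
    by constructor 3; apply: above_last.
  by move: wS; rewrite -(val_inj zw) zS.
have T_le z : z <= w -> z \in T.
  rewrite leq_eqVlt => /orP[/eqP/val_inj -> //|zw]; rewrite same //.
  have : z <= e by rewrite -yE yw1 ltnW // ltnW.
  by rewrite memU2 -[z == w]val_eqE ltn_eqF //= => /andP[].
(* T contains [0, w], and #|T| = w + 2 leaves room for one more element. *)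
have T_above t1 t2 : t1 \in T -> t2 \in T -> w < t1 -> w < t2 -> t1 = t2.
  move=> t1T t2T wt1 wt2; apply/eqP; apply: contraT => ne_t.
  have : t1 |: (t2 |: [set z : 'I_n | z <= w]) \subset T.
    apply/subsetP=> z; rewrite !inE => /or3P[/eqP->|/eqP->|/T_le] //.
  move/subset_leq_card; rewrite dT !cardsU1 card_initial_segment !inE.
  by rewrite negb_or ne_t -!ltnNge wt1 wt2 /= -wd !add1n ltnn.
have T_end t : is_end T t -> w <= t.
  move=> /andP[tT StT]; rewrite leqNgt; apply: contra StT => tw.
  by apply: T_le; rewrite ordS_small // (leq_ltn_trans tw (ltn_ord w)).
(* Of the two ends of T, none is below w and at most one is above w; so w is an
   end as well, which rules out t = w + 1. *)
have [t [tE wt wTE]] : exists t, [/\ is_end T t, w < t & is_end T w].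
  have [t1 [t2 [E1 E2 ne_t]]] := disconnected_ends T0 Tdis.
  have := T_end _ E1; rewrite leq_eqVlt => /orP[/eqP/val_inj w1|wt1].
    subst t1; exists t2; split=> //.
    by rewrite ltn_neqAle T_end // andbT.
  have := T_end _ E2; rewrite leq_eqVlt => /orP[/eqP/val_inj w2|wt2].
    by subst t2; exists t1.
  case/eqP: ne_t; have /andP[? _] := E1; have /andP[? _] := E2; exact: T_above.
have /andP[tT StT] := tE.
have yt : y < t.
  have /andP[_] := wTE; rewrite yw1 ltn_neqAle wt andbT => SwT.
  apply: contra SwT => /eqP wt1; suff -> : ordS w = t by [].
  by apply: val_inj; rewrite [LHS]ordS_small.
(* The successor 0 of the last vertex belongs to T, so the end t is not last. *)
have tl : t < last.
  rewrite ltn_neqAle -ltnS lastE ltn_ord andbT.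
  apply: contra StT => /eqP/val_inj ->.
  by apply: T_le; rewrite ordS_last.
have tS : t \notin S.
  apply/negP=> /S_cases[tw|ty|tl'].
  - by move: wt; rewrite ltnNge ltnW.
  - by rewrite ty ltnn in yt.
  - by rewrite tl' ltnn in tl.
exists t, (t |: (S :\ last)); split; split=> //.
- by apply: setUS; apply: subD1set.
- exact: card_swap.
(* The ends w - 1 and t disconnect the new set; w > 0 as #|S| = w + 2 > 2. *)
- have v_lt : w.-1 < n := leq_ltn_trans (leq_pred w) (ltn_ord w).
  have w_gt0 : 0 < w by move: d_ge3; rewrite -wd.
  pose v : 'I_n := Ordinal v_lt.
  have vw : v.+1 = w := prednK w_gt0.
  have lt_vw : v < w by rewrite -[X in _ < X]vw.
  have Sv : ordS v = w by apply: val_inj; rewrite [LHS]ordS_small vw.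
  have vS : v \in S by rewrite -same ?T_le // ltnW.
  apply: (@two_ends_disconnected _ _ v t); last exact: ltn_trans lt_vw wt.
    rewrite /is_end Sv !inE (negbTE wS) andbF orbF vS andbT.
    rewrite -!val_eqE !ltn_eqF //; first exact: ltn_trans lt_vw w_last.
    exact: ltn_trans lt_vw wt.
  have St : ordS t = t.+1 :> nat.
    by rewrite ordS_small // (leq_ltn_trans tl (ltn_ord last)).
  have /negbTE ne_St : ordS t != t.
    by apply/eqP=> /(congr1 (@nat_of_ord n)) /eqP; rewrite St eqn_leq ltnn.
  rewrite /is_end setU11 !inE ne_St.
  apply/negP=> /andP[ne_l /S_cases[lt|eq_y|eq_l]].
  - by move: lt; rewrite St ltnNge leqW // ltnW.
  - by move: yt; rewrite -eq_y St ltnNge leqnSn.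
  - by rewrite eq_l eqxx in ne_l.
- exact: lex_before_swap.
Qed.
End Exchange.

Theorem theorem3p3 (K : fieldType) (n : nat) (hn : (3 <= n)%N)
    (r : nat) (hr : (2 <= r)%N) :
  has_linear_resolution
    (edge_ideal K
       (clutter_compl r.+1 (connected_clutter r (cycle_graph n)))).
Proof.
set D := clutter_compl _ _.
have memD A :
    (A \in D) = (#|A| == r.+1) && ~~ induced_connected (cycle_graph n) A.
  by rewrite !inE; case: eqP.
have [As [AsD uAs] ltAs] := lex_sortedP D.
apply: (has_linear_resolution_edge_ideal (d := r.+1) K AsD) => //; last first.
  by move=> A; rewrite memD => /andP[/eqP].
apply: linear_quotients_lex ltAs _ => A B.
rewrite !AsD !memD => /andP[/eqP dA _] /andP[/eqP dB Bdis] BA.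
have [||x [C [[xB xA CxA] [dC Cdis CA]]]] := lex_exchange _ _ Bdis BA.
- by rewrite dA.
- by rewrite dA dB.
by exists x, C; split=> //; rewrite AsD memD dC dA eqxx.
Qed.
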